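(* Let $\mathcal H$ be a separable Hilbert space and let $M$ be an operator mean on $\mathcal P^\infty(\mathbb P)$. Then $M$ is contractive for the $\infty$-Wasserstein distance with respect to the Thompson metric $d_{\mathrm T}$; in fact, for every $\mu,\nu\in\mathcal P^\infty(\mathbb P)$, $$d_{\mathrm T}(M(\mu),M(\nu))\le\delta_{\mathrm T}(\mu,\nu)\le(d_{\mathrm T})^W_\infty(\mu,\nu).$$
   Context: $\mathcal H$ is a separable Hilbert space, $\mathbb P=\mathbb P(\mathcal H)$ is the set of positive invertible bounded operators on $\mathcal H$ with the operator norm topology, $A\le B$ means $B-A$ is positive semidefinite, and SOT is the strong operator topology. For $\varepsilon\in(0,1)$, $\Sigma_\varepsilon=\{A\in\mathbb P:\varepsilon I\le A\le\varepsilon^{-1}I\}$. $\mathcal P^\infty(\mathbb P)$ is the set of Borel (for the norm topology) probability measures $\mu$ on $\mathbb P$ with $\mu(\mathrm{supp}(\mu))=1$ and $\mathrm{supp}(\mu)\subset\Sigma_\varepsilon$ for some $\varepsilon\in(0,1)$. Stochastic order: $\mathcal U\subset\mathbb P$ is an upper set if $A\in\mathcal U$, $B\in\mathbb P$, $B\ge A$ imply $B\in\mathcal U$; $\mu\le\nu$ means $\mu(\mathcal U)\le\nu(\mathcal U)$ for every norm-closed upper set $\mathcal U$. Monotone convergence: for $\mu,\mu_k\in\mathcal P^\infty(\mathbb P)$ ($k\in\mathbb N$), $\mu_k\nearrow\mu$ (resp. $\mu_k\searrow\mu$) means (a) $\mu_1\le\mu_2\le\cdots\le\mu$ (resp. $\mu_1\ge\mu_2\ge\cdots\ge\mu$);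 then all $\mu_k$ and $\mu$ are supported on a common $\Sigma_\varepsilon$; and (b) $\int f\,d\mu_k\to\int f\,d\mu$ for every bounded SOT-continuous real function $f$ on $\Sigma_\varepsilon$ (independent of the choice of such $\varepsilon$). An operator mean on $\mathcal P^\infty(\mathbb P)$ is a map $M:\mathcal P^\infty(\mathbb P)\to\mathbb P$ such that: (i) $\mu\le\nu$ implies $M(\mu)\le M(\nu)$; (ii) $M(\alpha.\mu)=\alpha M(\mu)$ for all $\alpha>0$, where $\alpha.\mu$ is the push-forward of $\mu$ by $A\mapsto\alpha A$; (iii) if $\mu_k\searrow\mu$ or $\mu_k\nearrow\mu$ then $M(\mu_k)\to M(\mu)$ in SOT; (iv) $M(\delta_I)=I$. The Thompson metric on $\mathbb P$ is $d_{\mathrm T}(A,B)=\|\log A^{-1/2}BA^{-1/2}\|=\min\{r\ge0:e^{-r}B\le A\le e^rB\}$. For $\mu,\nu\in\mathcal P^\infty(\mathbb P)$, $\delta_{\mathrm T}(\mu,\nu)=\inf\{r\ge0:e^{-r}.\nu\le\mu\le e^r.\nu\}$, and $$(d_{\mathrm T})^W_\infty(\mu,\nu)=\inf_{\pi\in\Pi(\mu,\nu)}\sup\{d_{\mathrm T}(A,B):(A,B)\in\mathrm{supp}(\pi)\},$$ where $\Pi(\mu,\nu)$ is the set of Borel probability measures on $\mathbb P\times\mathbb P$ with marginals $\mu,\nu$. A map $\beta:\mathcal P^\infty(\mathbb P)\to\mathbb P$ is $(d_{\mathrm T})^W_\infty$-contractive if $d_{\mathrm T}(\beta(\mu),\beta(\nu))\le(d_{\mathrm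 T})^W_\infty(\mu,\nu)$ for all $\mu,\nu$. *)

(* Defs.v *)
From HB Require Import structures.
From mathcomp Require Import all_boot all_order all_algebra.
From mathcomp Require Import all_classical all_reals all_analysis.
From mathcomp Require Import complex.

Set Implicit Arguments.
Unset Strict Implicit.
Unset Printing Implicit Defensive.

Import Order.TTheory GRing.Theory Num.Theory.
Import numFieldNormedType.Exports.

Local Open Scope classical_set_scope.
Local Open Scope ring_scope.
Local Open Scope complex_scope.

HB.mixin Record isHilbert (R : realType) H & CompleteNormedModule R[i] H := {
  inner : {dot H for Num.conj};
  inner_norm : forall x : H, `|x| ^+ 2 = inner x x
}.

#[short(type="hilbertType")]
HB.structure Definition Hilbert (R : realType) :=
  {H of CompleteNormedModule R[i] H & isHilbert R H}.

Definition separable_space (T : topologicalType) :=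
  exists2 D : set T, countable D & dense D.

Lemma real_complexD (R : realType) (a b : R) : (a + b)%:C = a%:C + b%:C.
Proof. exact: (rmorphD (real_complex R)). Qed.

Lemma real_complexM (R : realType) (a b : R) : (a * b)%:C = a%:C * b%:C.
Proof. exact: (rmorphM (real_complex R)). Qed.

Lemma Re_normE (R : realType) (V : normedZmodType R[i]) (x : V) :
  (complex.Re `|x|)%:C = `|x|.
Proof. by rewrite RRe_real// normr_real. Qed.

Section bounded_operators.
Variables (R : realType) (V : normedModType R[i]).

Record bop := Bop {
  bop_fun :> V -> V ;
  bop_linear : linear bop_fun ;
  bop_bounded : exists K : R, forall x, `|bop_fun x| <= K%:C * `|x| }.

Implicit Types A B : bop.

Lemma bop_ext A B : A =1 B -> A = B.
Proof.
case: A B => [f fl fb] [g gl gb] /= /funext fg; subst g.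
by congr Bop; exact: Prop_irrelevance.
Qed.

HB.instance Definition _ := gen_eqMixin bop.
HB.instance Definition _ := gen_choiceMixin bop.

Lemma bop_zero_linear : linear (fun _ : V => 0 : V).
Proof. by move=> a x y; rewrite scaler0 addr0. Qed.
Lemma bop_zero_bounded :
  exists K : R, forall x : V, `|(0 : V)| <= K%:C * `|x|.
Proof. by exists 0 => x; rewrite normr0 mul0r. Qed.
Definition bop_zero := Bop bop_zero_linear bop_zero_bounded.

Lemma bop_id_linear : linear (fun x : V => x).
Proof. by []. Qed.
Lemma bop_id_bounded : exists K : R, forall x : V, `|x| <= K%:C * `|x|.
Proof. by exists 1 => x; rewrite mul1r. Qed.
Definition bop_id := Bop bop_id_linear bop_id_bounded.

Lemma bop_add_linear A B : linear (fun x => A x + B x).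
Proof.
by move=> a x y; rewrite !bop_linear scalerDr addrACA.
Qed.
Lemma bop_add_bounded A B :
  exists K : R, forall x, `|A x + B x| <= K%:C * `|x|.
Proof.
have [[K HK] [L HL]] := (bop_bounded A, bop_bounded B).
exists (K + L) => x; rewrite real_complexD mulrDl.
by rewrite (le_trans (ler_normD _ _))// lerD.
Qed.
Definition bop_add A B := Bop (bop_add_linear A B) (bop_add_bounded A B).

Lemma bop_scale_linear (c : R[i]) A : linear (fun x => c *: A x).
Proof.
by move=> a x y; rewrite bop_linear scalerDr !scalerA mulrC.
Qed.
Lemma bop_scale_bounded (c : R[i]) A :
  exists K : R, forall x, `|c *: A x| <= K%:C * `|x|.
Proof.
have [K HK] := bop_bounded A.
exists (complex.Re `|c| * K) => x; rewrite normrZ real_complexM -mulrA.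
by rewrite Re_normE ler_wpM2l.
Qed.
Definition bop_scale c A := Bop (bop_scale_linear c A) (bop_scale_bounded c A).

Lemma bop_opp_linear A : linear (fun x => - A x).
Proof.
by move=> a x y; rewrite bop_linear opprD scalerN.
Qed.
Lemma bop_opp_bounded A : exists K : R, forall x, `|- A x| <= K%:C * `|x|.
Proof.
by have [K HK] := bop_bounded A; exists K => x; rewrite normrN.
Qed.
Definition bop_opp A := Bop (bop_opp_linear A) (bop_opp_bounded A).

Lemma bop_addA : associative bop_add.
Proof. by move=> A B C; apply: bop_ext => x /=; rewrite addrA. Qed.
Lemma bop_addC : commutative bop_add.
Proof. by move=> A B; apply: bop_ext => x /=; rewrite addrC. Qed.
Lemma bop_add0 : left_id bop_zero bop_add.
Proof. by move=> A; apply: bop_ext => x /=; rewrite add0r. Qed.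
Lemma bop_addN : left_inverse bop_zero bop_opp bop_add.
Proof. by move=> A; apply: bop_ext => x /=; rewrite addNr. Qed.

HB.instance Definition _ :=
  GRing.isZmodule.Build bop bop_addA bop_addC bop_add0 bop_addN.

Lemma bop_scaleA a b A : bop_scale a (bop_scale b A) = bop_scale (a * b) A.
Proof. by apply: bop_ext => x /=; rewrite scalerA. Qed.
Lemma bop_scale1 : left_id 1 bop_scale.
Proof. by move=> A; apply: bop_ext => x /=; rewrite scale1r. Qed.
Lemma bop_scaleDr : right_distributive bop_scale +%R.
Proof. by move=> a A B; apply: bop_ext => x /=; rewrite scalerDr. Qed.
Lemma bop_scaleDl A : {morph bop_scale^~ A : a b / a + b}.
Proof. by move=> a b; apply: bop_ext => x /=; rewrite scalerDl. Qed.

HB.instance Definition _ := GRing.Zmodule_isLmodule.Build R[i] bop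
  bop_scaleA bop_scale1 bop_scaleDr bop_scaleDl.

Definition opnorm A : R :=
  sup [set complex.Re `|A x| | x in [set x | `|x| <= 1]].

Lemma bop0 A : A 0 = 0.
Proof.
have := bop_linear A 1 0 0; rewrite !scale1r addr0 => /eqP.
by rewrite -subr_eq subrr eq_sym => /eqP.
Qed.

Lemma bopZ A c x : A (c *: x) = c *: A x.
Proof. by have := bop_linear A c x 0; rewrite bop0 !addr0. Qed.

Lemma opnorm_has_sup A :
  has_sup [set complex.Re `|A x| | x in [set x | `|x| <= 1]].
Proof.
split; first by exists (complex.Re `|A 0|), 0 => //=; rewrite normr0.
have [K HK] := bop_bounded A; exists `|K| => _ [x /= x1 <-].
rewrite -lecR Re_normE (le_trans (HK x))//.
rewrite (@le_trans _ _ (`|K|%:C * `|x|))//.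
  by rewrite ler_wpM2r// lecR ler_norm.
by rewrite -[leRHS]mulr1 ler_wpM2l// ler0c.
Qed.

Lemma opnorm_ge0 A : 0 <= opnorm A.
Proof.
have := ub_le_sup (opnorm_has_sup A).2; apply.
by exists 0; rewrite /= ?bop0 ?normr0.
Qed.

Lemma opnorm_bound A x : `|A x| <= (opnorm A)%:C * `|x|.
Proof.
have [->|x0] := eqVneq x 0; first by rewrite bop0 !normr0 mulr0.
have nx0 : 0 < `|x| by rewrite normr_gt0.
rewrite -ler_pdivrMr//.
have -> : `|A x| / `|x| = `|A (`|x|^-1 *: x)|.
  by rewrite bopZ normrZ normrV ?unitfE ?gt_eqF// normr_id mulrC.
rewrite -Re_normE lecR.
have := ub_le_sup (opnorm_has_sup A).2; apply.
exists (`|x|^-1 *: x) => //=.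
by rewrite normrZ normrV ?unitfE ?gt_eqF// normr_id mulVf// gt_eqF.
Qed.

Lemma opnorm_le A (K : R) :
  (forall x, `|x| <= 1 -> `|A x| <= K%:C) -> opnorm A <= K.
Proof.
move=> AK; apply: ge_sup; first exact: (opnorm_has_sup A).1.
by move=> _ [x /= x1 <-]; rewrite -lecR Re_normE AK.
Qed.

Lemma bop_ler_normD A B :
  (opnorm (A + B))%:C <= (opnorm A)%:C + (opnorm B)%:C.
Proof.
rewrite -real_complexD lecR; apply: opnorm_le => x x1.
rewrite (le_trans (ler_normD _ _))// real_complexD lerD//.
  rewrite (le_trans (opnorm_bound A x))// -[leRHS]mulr1.
  by rewrite ler_wpM2l// ler0c opnorm_ge0.
rewrite (le_trans (opnorm_bound B x))// -[leRHS]mulr1.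
by rewrite ler_wpM2l// ler0c opnorm_ge0.
Qed.

Lemma bop_opnormZ_le (c : R[i]) A : (opnorm (c *: A))%:C <= `|c| * (opnorm A)%:C.
Proof.
rewrite -[`|c|]Re_normE -real_complexM lecR; apply: opnorm_le => x x1.
rewrite -[(c *: A) x]/(c *: A x) normrZ real_complexM Re_normE ler_wpM2l//.
rewrite (le_trans (opnorm_bound A x))// -[leRHS]mulr1.
by rewrite ler_wpM2l// ler0c opnorm_ge0.
Qed.

Lemma bop_normrZ (c : R[i]) A : (opnorm (c *: A))%:C = `|c| * (opnorm A)%:C.
Proof.
apply/eqP; rewrite eq_le bop_opnormZ_le/=.
have [->|c0] := eqVneq c 0; first by rewrite normr0 mul0r ler0c opnorm_ge0.
rewrite mulrC -ler_pdivlMr ?normr_gt0// mulrC -normfV.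
by rewrite (le_trans _ (bop_opnormZ_le _ _))// scalerA mulVf// scale1r.
Qed.

Lemma bop_normr0_eq0 A : (opnorm A)%:C = 0 -> A = 0.
Proof.
move=> A0; apply: bop_ext => x; apply/eqP; rewrite -normr_le0.
by rewrite (le_trans (opnorm_bound A x))// A0 mul0r.
Qed.

HB.instance Definition _ := Lmodule_isNormed.Build R[i] bop
  bop_ler_normD bop_normrZ bop_normr0_eq0.

End bounded_operators.

HB.instance Definition _ (T U : ptopologicalType) :=
  Topological.on (T * U)%type.

(* The Borel sigma-algebra. On a product it is generated by the open sets of
   the product topology; for non-separable spaces this may be strictly larger
   than the product of the Borel sigma-algebras. *)
Definition borel (T : ptopologicalType) := g_sigma_algebraType (@open T).
HB.instance Definition _ (T : ptopologicalType) := Measurable.on (borel T).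

Definition supp (R : realType) (T : ptopologicalType)
    (mu : set (borel T) -> \bar R) : set T :=
  [set x | forall U : set T, open U -> U x -> (0 < mu U)%E].

Section positive_operators.
Variables (R : realType) (H : hilbertType R).

(* [0 <= z] for [z : R[i]] says that z is real and nonnegative. *)
Definition psd (A : bop H) := forall x, 0 <= inner (A x) x.
Definition lople (A B : bop H) := psd (B - A).

Definition invertible_op (A : bop H) :=
  exists B : bop H, cancel A B /\ cancel B A.

Definition posinv : set (bop H) := [set A | psd A /\ invertible_op A].

Definition posop := set_type posinv.
HB.instance Definition _ := Choice.on posop.
HB.instance Definition _ := Uniform.on posop.

Definition posop_val (A : posop) : bop H := set_val A.
Coercion posop_val : posop >-> bop.

Lemma posop_idP : bop_id H \in posinv.
Proof.
rewrite inE; split; last by exists (bop_id H).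
by move=> x; rewrite -inner_norm exprn_ge0.
Qed.
Definition posop_id : posop := exist _ (bop_id H) posop_idP.

HB.instance Definition _ := isPointed.Build posop posop_id.

Lemma posop_scaleP (a : {posnum R}) (A : posop) :
  (a%:num%:C *: (A : bop H)) \in posinv.
Proof.
have a0 : (a%:num%:C : R[i]) != 0.
  by apply/eqP => /complexI/eqP; rewrite gt_eqF.
have [psdA [B [AB BA]]] := set_mem (valP A).
rewrite inE; split.
  move=> x; rewrite -[((_ *: _) : bop H) x]/(a%:num%:C *: A x).
  by rewrite linearZl_LR/= mulr_ge0// ler0c.
exists (a%:num%:C^-1 *: B); split => x.
  rewrite -[((a%:num%:C^-1 *: B) : bop H) _]/(a%:num%:C^-1 *: B _).
  by rewrite -[(a%:num%:C *: (A : bop H)) x]/(a%:num%:C *: A x) bopZ AB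
             scalerA mulVf ?scale1r.
rewrite -[((a%:num%:C^-1 *: B) : bop H) _]/(a%:num%:C^-1 *: B _).
rewrite -[(a%:num%:C *: (A : bop H)) _]/(a%:num%:C *: A _) bopZ.
by rewrite BA scalerA mulfV ?scale1r.
Qed.
Definition posop_scale (a : {posnum R}) (A : posop) : posop :=
  exist _ (a%:num%:C *: (A : bop H)) (posop_scaleP a A).

End positive_operators.

Arguments posinv {R} H.
Arguments posop_id {R} H.

Section wasserstein_setting.
Variables (R : realType) (H : hilbertType R).
Local Notation P := (posop H).
Local Notation I := (bop_id H).

Definition Sigma_ (eps : R) : set P :=
  [set A : P | lople (eps%:C *: I) A /\ lople A (eps^-1%:C *: I)].

(* P with the strong operator topology *)
Definition sot := initial_topology (fun A : P => (A : H -> H) : {ptws H -> H}).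
HB.instance Definition _ := Topological.on sot.

Lemma posop_scale_continuous (a : {posnum R}) :
  continuous (@posop_scale R H a).
Proof.
have cv : continuous (@posop_val R H : P -> bop H).
  exact: (@initial_continuous _ _ set_val).
apply: (@continuous_comp_initial _ _ _ (@set_val _ (posinv H))).
have cs : continuous (fun B : P => a%:num%:C *: posop_val B).
  move=> A; apply: (@continuous_comp _ _ _ (@posop_val R H)
    (fun B : bop H => a%:num%:C *: B)); first exact: cv.
  exact: scaler_continuous.
exact: cs.
Qed.

Lemma posop_scale_measurable (a : {posnum R}) :
  measurable_fun [set: borel P] (posop_scale a : borel P -> borel P).
Proof.
apply: (@measurability _ _ (borel P) (borel P) setT _ (@open P)) => //.
move=> _ [U oU <-]; rewrite setTI; apply: sub_sigma_algebra.
by apply: open_comp => // x _; exact: posop_scale_continuous.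
Qed.
HB.instance Definition _ (a : {posnum R}) :=
  isMeasurableFun.Build _ _ (borel P) (borel P)
    (posop_scale a : borel P -> borel P) (posop_scale_measurable a).

Definition Pinf_cond (mu : probability (borel P) R) : Prop :=
  mu (supp mu) = 1%E /\
  exists2 eps : R, 0 < eps < 1 & supp mu `<=` Sigma_ eps.

Record Pinf := MkPinf {
  Pinf_prob :> probability (borel P) R ;
  Pinf_condP : Pinf_cond Pinf_prob }.

Definition pscale (a : {posnum R}) (mu : probability (borel P) R) :
    probability (borel P) R :=
  distribution mu (posop_scale a : borel P -> borel P).

Lemma posop_scaleK (a b : {posnum R}) : a%:num * b%:num = 1 ->
  cancel (@posop_scale R H a) (posop_scale b).
Proof.
move=> ab A; apply: val_inj; apply: bop_ext => x /=.
by rewrite scalerA -real_complexM mulrC ab scale1r.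
Qed.

Lemma supp_pscale (a : {posnum R}) (mu : probability (borel P) R) (A : P) :
  supp (pscale a mu) (posop_scale a A) <-> supp mu A.
Proof.
have ai0 : 0 < a%:num^-1 by []; pose b := PosNum ai0.
have aK : cancel (@posop_scale R H a) (posop_scale b).
  by apply: posop_scaleK; rewrite /= mulfV.
split=> sA U oU UA.
  have := sA (posop_scale b @^-1` U).
  have -> : pscale a mu (posop_scale b @^-1` U) = mu U.
    rewrite /pscale /= /distribution /pushforward; congr (mu _).
    by apply/funext => B /=; rewrite aK.
  apply; last by rewrite /= aK.
  by apply: open_comp => // x _; exact: posop_scale_continuous.
apply: (sA (posop_scale a @^-1` U)) => //.
by apply: open_comp => // x _; exact: posop_scale_continuous.
Qed.

Lemma lople_scale (a : R) (A B : bop H) : 0 <= a ->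
  lople A B -> lople (a%:C *: A) (a%:C *: B).
Proof.
move=> a0 AB x; rewrite -scalerBr.
rewrite -[((_ *: _) : bop H) x]/(a%:C *: (B - A) x) linearZl_LR/=.
by apply: mulr_ge0; [rewrite ler0c|exact: AB].
Qed.

Lemma lople_id (a b : R) : a <= b -> lople (a%:C *: I) (b%:C *: I).
Proof.
move=> ab x; rewrite -scalerBl -[((_ *: _) : bop H) x]/((b%:C - a%:C) *: x).
rewrite linearZl_LR/=; apply: mulr_ge0; first by rewrite subr_ge0 lecR.
by rewrite -inner_norm exprn_ge0.
Qed.

Lemma lople_trans (B A C : bop H) : lople A B -> lople B C -> lople A C.
Proof.
move=> AB BC x; have -> : C - A = (C - B) + (B - A) by rewrite addrA subrK.
rewrite -[((_ + _) : bop H) x]/((C - B) x + (B - A) x) linearDl addr_ge0//.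
  exact: BC.
exact: AB.
Qed.

Lemma pscale_Pinf (a : {posnum R}) (mu : Pinf) : Pinf_cond (pscale a mu).
Proof.
have [mu1 [e /andP[e0 e1] se]] := Pinf_condP mu; split.
  rewrite -mu1 /pscale /= /distribution /pushforward; congr ((mu : set _ -> _) _).
  by apply/funext => A; apply/propext; exact: supp_pscale.
pose d := Num.min e (Num.min (a%:num * e) (a%:num^-1 * e)).
have d0 : 0 < d by rewrite !lt_min e0 !mulr_gt0.
exists d; first by rewrite d0 (le_lt_trans _ e1)// ge_min lexx.
have ai0 : 0 < a%:num^-1 by []; pose b := PosNum ai0.
have bK : cancel (@posop_scale R H b) (posop_scale a).
  by apply: posop_scaleK; rewrite /= mulVf.
move=> A; rewrite -[A]bK => /supp_pscale/se[l u]; split.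
  apply: lople_trans (lople_scale _ l); last by [].
  rewrite scalerA -real_complexM; apply: lople_id.
  by rewrite !ge_min lexx orbT.
apply: lople_trans (lople_scale _ u) _; first by [].
rewrite scalerA -real_complexM; apply: lople_id.
rewrite -[a%:num]invrK -invfM lef_pV2 ?posrE ?mulr_gt0 ?invr_gt0//.
by rewrite !ge_min lexx !orbT.
Qed.

Definition Pinf_scale (a : {posnum R}) (mu : Pinf) : Pinf :=
  MkPinf (pscale_Pinf a mu).

Lemma dirac_Pinf : Pinf_cond (dirac (posop_id H : borel P) : probability _ R).
Proof.
have hP : hausdorff_space P.
  move=> A B AB; apply: val_inj.
  apply: (@norm_hausdorff _ (bop H)) => U V nU nV.
  have cv : continuous (@posop_val R H : P -> bop H).
    exact: (@initial_continuous _ _ set_val).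
  have [C [UC VC]] := AB _ _ (cv _ _ nU) (cv _ _ nV).
  by exists (posop_val C).
split.
  rewrite /= /dirac indicE mem_set// => U _ UI.
  by rewrite /= /dirac indicE mem_set.
exists (2^-1); first by rewrite invr_gt0 ltr0n/= invf_lt1// ltr1n.
move=> A /= sA.
have -> : A = posop_id H.
  apply/eqP/negPn/negP => AI.
  have := sA (~` [set posop_id H]).
  rewrite /= /dirac indicE memNset; last by move=> /(_ erefl).
  rewrite ltxx => h; suff: false by [].
  apply: h; last by move=> /eqP; rewrite (negbTE AI).
  rewrite openC; apply: accessible_closed_set1.
  exact: hausdorff_accessible.
have I1 : (posop_id H : bop H) = 1%:C *: I by rewrite scale1r.
split; rewrite I1; apply: lople_id; first by rewrite invf_le1 ?ler1n.
by rewrite invrK ler1n.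
Qed.

Definition Pinf_dirac_id : Pinf := MkPinf dirac_Pinf.

Definition upper_set (U : set P) := forall A B : P, U A -> lople A B -> U B.

Definition sto_le (mu nu : probability (borel P) R) :=
  forall U : set P, closed U -> upper_set U -> (mu U <= nu U)%E.

(* Convergence of integrals of bounded SOT-continuous functions on some Sigma_eps
   that contains all the supports. *)
Definition sot_weak_cvg (mu_ : nat -> Pinf) (mu : Pinf) :=
  exists eps : R, [/\ 0 < eps < 1,
    forall k, supp (mu_ k) `<=` Sigma_ eps,
    supp mu `<=` Sigma_ eps &
    forall f : sot -> R,
      [bounded f A | A in (Sigma_ eps : set sot)] ->
      {within (Sigma_ eps : set sot), continuous f} ->
      \int[mu_ k]_(A in Sigma_ eps) f A @[k --> \oo] -->
        \int[mu]_(A in Sigma_ eps) f A].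

Definition cvg_up (mu_ : nat -> Pinf) (mu : Pinf) :=
  [/\ forall k, sto_le (mu_ k) (mu_ k.+1), forall k, sto_le (mu_ k) mu &
      sot_weak_cvg mu_ mu].

Definition cvg_down (mu_ : nat -> Pinf) (mu : Pinf) :=
  [/\ forall k, sto_le (mu_ k.+1) (mu_ k), forall k, sto_le mu (mu_ k) &
      sot_weak_cvg mu_ mu].

Record operator_mean (M : Pinf -> P) : Prop := {
  mean_monotone : forall mu nu : Pinf, sto_le mu nu -> lople (M mu) (M nu) ;
  mean_homogeneous : forall (a : {posnum R}) (mu : Pinf),
    M (Pinf_scale a mu) = posop_scale a (M mu) ;
  mean_cvg : forall (mu_ : nat -> Pinf) (mu : Pinf),
    cvg_down mu_ mu \/ cvg_up mu_ mu ->
    (M (mu_ k) : sot) @[k --> \oo] --> (M mu : sot) ;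
  mean_id : M Pinf_dirac_id = posop_id H }.

(* This is the formula min {r >= 0 | e^-r B <= A <= e^r B} for the Thompson
   metric || log (A^-1/2 B A^-1/2) ||; the set is nonempty and its infimum is
   attained. *)
Definition thompson (A B : P) : R :=
  inf [set r : R | 0 <= r /\
    (lople ((expR (- r))%:C *: (B : bop H)) A /\
     lople A ((expR r)%:C *: (B : bop H)))].

Definition delta_T (mu nu : Pinf) : \bar R :=
  ereal_inf [set r%:E | r in [set r : R | 0 <= r /\
    (sto_le (pscale (PosNum (expR_gt0 (- r))) nu) mu /\
     sto_le mu (pscale (PosNum (expR_gt0 r)) nu))]].

Definition coupling (mu nu : Pinf) : set (probability (borel (P * P)%type) R) :=
  [set pi | forall U : set (borel P), measurable U ->
     pi (fst @^-1` U) = mu U /\ pi (snd @^-1` U) = nu U].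

(* No junk value arises from an empty supremum: supp pi is nonempty for every
   coupling pi, because mu and nu are carried by their (separable) supports. *)
Definition thompson_Winf (mu nu : Pinf) : \bar R :=
  ereal_inf [set ereal_sup [set (thompson AB.1 AB.2)%:E | AB in supp pi]
            | pi in coupling mu nu].

Definition Winf_contractive (beta : Pinf -> P) :=
  forall mu nu : Pinf,
    ((thompson (beta mu) (beta nu))%:E <= thompson_Winf mu nu)%E.

End wasserstein_setting.

(* Main.v *)
Require Import Defs.
From HB Require Import structures.
From mathcomp Require Import all_boot all_order all_algebra.
From mathcomp Require Import all_classical all_reals all_analysis.
From mathcomp Require Import complex.

(** If [e^-r.nu <= mu <= e^r.nu], monotonicity and homogeneity of [M] give
    [e^-r M(nu) <= M(mu) <= e^r M(nu)]; hence the first inequality.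

    For the second, let [pi] be a coupling and let [s] exceed the Thompson
    distance on [supp pi], so that [e^-s B <= A <= e^s B] for [(A, B)] in
    [supp pi]. If [pi] is carried by its support, then, for an upper set [U],
    [A \in U] implies [e^s B \in U] [pi]-almost surely, whence
    [mu <= e^s.nu], and likewise [e^-s.nu <= mu].

    As the space of operators need not be norm-separable, that [pi] is carried
    by its support needs an argument: the supports of [mu] and [nu] are
    separable, because disjoint balls centred in the support of a probability
    measure have positive mass and so form a countable family. The part of the
    complement of [supp pi] above [supp mu * supp nu] is therefore a countable
    union of null open rectangles. *)

Set Implicit Arguments.
Unset Strict Implicit.
Unset Printing Implicit Defensive.

Import Order.TTheory GRing.Theory Num.Theory.
Import numFieldNormedType.Exports.

Local Open Scope classical_set_scope.
Local Open Scope ring_scope.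

(** * Disjoint families of sets of positive mass *)

Lemma trivIset_probability_gt0_countable {d} {T : measurableType d}
    {R : realType} (P : probability T R) {I : pointedType} (D : set I)
    (F : I -> set T) :
  (forall i, D i -> measurable (F i)) -> trivIset D F ->
  (forall i, D i -> (0 < P (F i))%E) -> countable D.
Proof.
move=> mF tF PF0.
have Ffin i : D i -> P (F i) \is a fin_num.
  by move=> Di; rewrite fin_num_measure//; exact: mF.
(* Each [E n] is finite, since [n.+1] disjoint sets of mass above [1/(n+1)] would have total mass
   above 1. *)
pose E n := [set i | D i /\ (n.+1%:R^-1%:E < P (F i))%E].
apply: (@sub_countable _ _ _ (\bigcup_n E n)).
  apply: subset_card_le => i Di.
  have := PF0 _ Di; rewrite -(fineK (Ffin _ Di)) lte_fin => /ltr_add_invr[k].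
  rewrite add0r => kF; exists k => //; split=> //.
  by rewrite -(fineK (Ffin _ Di)) lte_fin.
apply: bigcup_countable => // n _; apply: finite_set_countable.
apply: contrapT => /infiniteP/pcard_leP/injfunPex[/= q q_fun q_inj].
have Dq k : D (q k) by have [] := q_fun k Logic.I.
have /(probability_le1 P) : measurable (\bigcup_k F (q k)).
  by apply: bigcup_measurable => k _; exact: mF.
rewrite leNgt => /negP; apply.
rewrite [ltRHS](_ : _ = (\sum_(0 <= k <oo) P (F (q k)))%E); last first.
  rewrite measure_bigcup//=; first by apply: eq_eseriesl =>// i; rewrite in_setT.
    by move=> i _; exact: mF.
  apply/trivIsetP => i j _ _ ij; move/trivIsetP : tF; apply => //.
  by apply: contra_neq ij; apply: q_inj; rewrite inE.
apply: (lt_le_trans _ (nneseries_lim_ge n.+1 _)) => //.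
rewrite -EFin_sum_fine//; last by move=> k _; exact: Ffin.
rewrite lte_fin (_ : 1%R = (\sum_(0 <= k < n.+1) n.+1%:R^-1:R)%R); last first.
  by rewrite sumr_const_nat subn0 -[RHS]mulr_natr mulVf.
apply: ltr_sum => // k _; have [_] := q_fun k Logic.I.
by rewrite -(fineK (Ffin _ (Dq k))) lte_fin.
Qed.

(** * Supports and null sets *)

Section support.
Context {R : realType} {T : ptopologicalType}.
Implicit Type mu : probability (borel T) R.

Lemma borel_open (U : set T) : open U -> measurable (U : set (borel T)).
Proof. exact: sub_sigma_algebra. Qed.

Lemma borel_closed (U : set T) : closed U -> measurable (U : set (borel T)).
Proof.
move=> cU; rewrite -[U]setCK; apply: measurableC; apply: borel_open.
exact: closed_openC.
Qed.

Lemma closed_supp mu : closed (supp mu).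
Proof.
move=> x clx U oU Ux.
have [y [sy Uy]] := clx U (open_nbhs_nbhs (conj oU Ux)).
exact: sy.
Qed.

Lemma suppPn mu x : ~ supp mu x ->
  exists U : set T, [/\ open U, U x & mu U = 0%E].
Proof.
move=> /existsNP[U] /not_implyP[oU] /not_implyP[Ux] /negP; rewrite -leNgt => U0.
by exists U; split => //; apply/eqP; rewrite eq_le U0 measure_ge0.
Qed.

(** The members of [C] are open in all of [T], not just relative to [S], so that products of members
    are open, hence Borel, in the product space. *)
Definition countable_base_on (S : set T) (C : set (set T)) :=
  [/\ countable C, C `<=` open & forall x (U : set T),
    S x -> open U -> U x -> exists V, [/\ C V, V x & V `<=` U]].

End support.

Section product_topology.
Context {T U : topologicalType}.

Lemma fst_continuous : continuous (@fst T U).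
Proof. by move=> x; exact: cvg_fst. Qed.

Lemma snd_continuous : continuous (@snd T U).
Proof. by move=> x; exact: cvg_snd. Qed.

Lemma openX (V : set T) (W : set U) : open V -> open W -> open (V `*` W).
Proof.
move=> oV oW; rewrite (_ : V `*` W = fst @^-1` V `&` snd @^-1` W)//.
by apply: openI; apply: open_comp => // x _;
  [exact: fst_continuous|exact: snd_continuous].
Qed.

End product_topology.

Lemma negligible_countable_bigcup {d} {T : measurableType d} {R : realType}
    (mu : {measure set T -> \bar R}) {I : Type} (D : set I) (F : I -> set T) :
  countable D -> (forall i, D i -> mu.-negligible (F i)) ->
  mu.-negligible (\bigcup_(i in D) F i).
Proof.
move=> /pfcard_geP[->|[f]] F0.
  by rewrite bigcup_set0; exact: negligible_set0.
apply: (@negligibleS _ _ _ _ (\bigcup_k F (f k))).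
  by move=> x [i Di Fx]; have [k _ fk] := @surj _ _ _ _ f _ Di; exists k => //; rewrite fk.
by apply: negligible_bigcup => k; apply: F0; exact: funS.
Qed.

(** A point outside [supp pi] with coordinates in [S] and [S'] has a null open neighbourhood, hence
    lies in a null product of members of [C] and [C']; only countably many such products exist. *)
Lemma negligible_suppC_prod {R : realType} {T U : ptopologicalType}
    (pi : probability (borel (T * U)%type) R) (S : set T) (S' : set U)
    (C : set (set T)) (C' : set (set U)) :
  countable_base_on S C -> countable_base_on S' C' ->
  pi.-negligible (fst @^-1` (~` S)) -> pi.-negligible (snd @^-1` (~` S')) ->
  pi.-negligible (~` supp pi).
Proof.
move=> [cC oC bC] [cC' oC' bC'] nS nS'.
pose D := [set VW : set T * set U | [/\ C VW.1, C' VW.2 &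
  pi (VW.1 `*` VW.2) = 0%E]].
have oVW VW : D VW -> open (VW.1 `*` VW.2).
  by move=> [/oC ? /oC' ? _]; exact: openX.
have nD : pi.-negligible (\bigcup_(VW in D) (VW.1 `*` VW.2)).
  apply: negligible_countable_bigcup.
    apply: (sub_countable _ (countableX cC cC')).
    by apply: subset_card_le => -[V W] [].
  by move=> VW DVW; apply/negligibleP; [apply: borel_open; exact: oVW|case: DVW].
apply: negligibleS (negligibleU nS (negligibleU nS' nD)).
move=> [x y] /suppPn[N [oN Nxy N0]].
have [Sx|] := pselect (S x); last by left.
have [Sy|] := pselect (S' y); last by right; left.
right; right.
have [[V W] /= [nV nW] VWN] : nbhs (x, y) N by exact: open_nbhs_nbhs.
move: nV nW; rewrite !nbhsE/= => -[V0 [oV0 V0x] V0V] [W0 [oW0 W0y] W0W].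
have [V1 [CV1 V1x V1V]] := bC _ _ Sx oV0 V0x.
have [W1 [CW1 W1y W1W]] := bC' _ _ Sy oW0 W0y.
exists (V1, W1) => //; split=> //=.
apply/eqP; rewrite eq_le measure_ge0 andbT -N0 le_measure ?inE//.
- by apply: borel_open; apply: openX; [exact: oC|exact: oC'].
- exact: borel_open.
- move=> [a b] [/= Va Wb]; apply: VWN.
  by split => /=; [exact/V0V/V1V|exact/W0W/W1W].
Qed.

Lemma supp_le_measure {R : realType} {T : ptopologicalType}
    (mu : probability (borel T) R) (X Y : set (borel T)) :
  mu.-negligible (~` supp mu) -> measurable X -> measurable Y ->
  supp mu `&` X `<=` Y -> (mu X <= mu Y)%E.
Proof.
have mS : measurable (~` supp mu : set (borel T)).
  by apply: measurableC; apply: borel_closed; exact: closed_supp.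
move=> /(negligibleP _ mS) S0 mX mY XY.
rewrite -(measureU0 mY mS S0) le_measure ?inE//; first exact: measurableU.
move=> x Xx; have [sx|] := pselect (supp mu x); last by right.
by left; exact: XY.
Qed.

(** * Separability of supports in the operator norm *)

Section operators.
Context {R : realType} {H : hilbertType R}.
Local Notation P := (posop H).
Implicit Types (A B : P) (mu nu : Pinf H).

Definition opball (A : P) (r : R) : set P :=
  @posop_val R H @^-1` ball (posop_val A) r%:C%C.

Lemma posop_val_continuous : continuous (@posop_val R H : P -> bop H).
Proof. exact: (@initial_continuous _ _ set_val). Qed.

Lemma open_opball A r : open (opball A r).
Proof.
by apply: open_comp => [x _|]; [exact: posop_val_continuous|exact: ball_open].
Qed.

Lemma opball_center A r : 0 < r -> opball A r A.
Proof.
move=> r0; have rc0 : 0 < r%:C%C by rewrite ltcR.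
exact: (ball_center _ (PosNum rc0)).
Qed.

Lemma opball_triangle B A C (r s : R) :
  opball A r B -> opball C s B -> opball A (r + s) C.
Proof.
by rewrite /opball/= real_complexD => AB /ball_sym; exact: ball_triangle.
Qed.

Lemma open_opball_sub (U : set P) A : open U -> U A ->
  exists n, opball A n.+1%:R^-1 `<=` U.
Proof.
move=> [V oV <-] VA.
have /nbhs_ballP[e /= e0 eV] : nbhs (posop_val A) V by exact: open_nbhs_nbhs.
(* Radii in [bop H] are elements of [R[i]]; a positive one is real, so it can be compared with
   [1/(n+1)] in [R]. *)
have e0' : 0 < complex.Re e by move: e0; rewrite ltcE => /andP[].
have ee : e = (complex.Re e)%:C%C by rewrite RRe_real// gtr0_real.
have [n] := ltr_add_invr e0'; rewrite add0r => ne; exists n => B AB; apply: eV.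
by rewrite ee; apply: le_ball AB; rewrite lecR ltW.
Qed.

(** Take a maximal family of disjoint balls of radius [r / 2] centred in the support. They have
    positive mass, so they are countably many; by maximality the half-ball of any other support
    point meets one of them, which puts the point within [r] of its centre. *)
Lemma supp_net (mu : probability (borel P) R) (r : R) : 0 < r ->
  exists2 D : set P, countable D &
    forall A, supp mu A -> exists2 B, D B & opball B r A.
Proof.
move=> r0; have r20 : 0 < r / 2 by rewrite divr_gt0.
have [D [DS tD maxD]] := ex_maximal_disjoint_subcollection
  (fun A => opball A (r / 2)) (supp mu).
exists D.
  apply: (trivIset_probability_gt0_countable (P := mu)) tD _.
    by move=> A _; apply: borel_open; exact: open_opball.
  by move=> A /DS; apply; [exact: open_opball|exact: opball_center].
move=> A SA; apply: contrapT => /forall2NP nA.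
have far B : D B -> opball A (r / 2) `&` opball B (r / 2) = set0.
  move=> DB; apply/eqP/negPn/negP => /set0P[C [AC BC]].
  have [//|] := nA B; apply; rewrite [r]splitr.
  exact: opball_triangle BC AC.
have DA : ~ D A.
  move=> /far; rewrite setIid => /seteqP[/(_ A) + _]; apply.
  exact: opball_center.
(* By [far], adding [A] keeps the balls disjoint, against maximality. *)
apply: (maxD (A |` D)).
- by split; [exact: subsetUr|move=> /(_ A (or_introl erefl))].
- by move=> B [->|/DS].
- apply/trivIsetP => B C [->|DB] [->|DC] BC.
  + by move: BC; rewrite eqxx.
  + exact: far.
  + by rewrite setIC; exact: far.
  + by move/trivIsetP : tD; exact.
Qed.

Lemma supp_countable_base (mu : probability (borel P) R) :
  exists C, countable_base_on (supp mu) C.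
Proof.
have r0 n : 0 < n.+1%:R^-1 / 2 :> R by rewrite divr_gt0.
have /choice[D cD] : forall n, exists D : set P, countable D /\
    forall A, supp mu A -> exists2 B, D B & opball B (n.+1%:R^-1 / 2) A.
  by move=> n; have [D ? ?] := supp_net mu (r0 n); exists D.
exists (\bigcup_n [set opball B (n.+1%:R^-1 / 2) | B in D n]); split.
- apply: bigcup_countable => // n _; apply: card_le_trans (cD n).1.
  exact: card_image_le.
- by move=> _ [n _ [B _ <-]]; exact: open_opball.
- move=> A U SA oU UA; have [n nU] := open_opball_sub oU UA.
  have [B DB BA] := (cD n).2 A SA.
  (* The radius is halved because two points of one ball are only within its diameter of each
     other. *)
  exists (opball B (n.+1%:R^-1 / 2)); split => //; first by exists n => //; exists B.
  move=> C BC; apply: nU; rewrite [_^-1]splitr.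
  apply: (@opball_triangle B); first exact/ball_sym.
  exact/ball_sym.
Qed.

Lemma Pinf_negligible_suppC mu : (mu : probability (borel P) R).-negligible (~` supp mu).
Proof.
have mS : measurable (supp mu : set (borel P)) by apply: borel_closed; exact: closed_supp.
apply/negligibleP; first exact: measurableC.
by rewrite [LHS](probability_setC _ mS) (Pinf_condP mu).1 subee.
Qed.

(** The marginals of [pi] make the preimages of the complements of [supp mu] and [supp nu] null,
    which leaves the part above two sets with countable bases. *)
Lemma coupling_negligible_suppC mu nu pi : coupling mu nu pi ->
  pi.-negligible (~` supp pi).
Proof.
move=> c; have [C bC] := supp_countable_base mu.
have [C' bC'] := supp_countable_base nu.
have mS (m : Pinf H) : measurable (~` supp m : set (borel P)).
  by apply: measurableC; apply: borel_closed; exact: closed_supp.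
apply: (negligible_suppC_prod bC bC').
  apply/negligibleP.
    apply: borel_open; apply: open_comp => [x _|]; first exact: fst_continuous.
    exact/closed_openC/closed_supp.
  by rewrite [LHS](c _ (mS mu)).1; apply/negligibleP => //; exact: Pinf_negligible_suppC.
apply/negligibleP.
  apply: borel_open; apply: open_comp => [x _|]; first exact: snd_continuous.
  exact/closed_openC/closed_supp.
by rewrite [LHS](c _ (mS nu)).2; apply/negligibleP => //; exact: Pinf_negligible_suppC.
Qed.

Lemma coupling_supp mu nu pi AB : coupling mu nu pi -> supp pi AB ->
  supp mu AB.1 /\ supp nu AB.2.
Proof.
move=> c sAB; split => U oU UA.
  rewrite -(c U (borel_open oU)).1; apply: sAB => //.
  by apply: open_comp => // x _; exact: fst_continuous.
rewrite -(c U (borel_open oU)).2; apply: sAB => //.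
by apply: open_comp => // x _; exact: snd_continuous.
Qed.

(** * Order bounds behind the Thompson metric *)

Lemma lople_scale_le (A : P) (a b : R) : a <= b ->
  lople (a%:C%C *: (A : bop H)) (b%:C%C *: (A : bop H)).
Proof.
move=> ab x; rewrite -scalerBl -[((_ *: _) : bop H) x]/((b%:C%C - a%:C%C) *: A x).
rewrite linearZl_LR/=; apply: mulr_ge0; first by rewrite subr_ge0 lecR.
by have [+ _] := set_mem (valP A); exact.
Qed.

Definition thompson_set A B : set R := [set r : R | 0 <= r /\
  (lople ((expR (- r))%:C%C *: (B : bop H)) A /\
   lople A ((expR r)%:C%C *: (B : bop H)))].

(** This rules out the default value of [inf] on the empty set in [thompson]. *)
Lemma Sigma_thompson_set_neq0 A B (e e' : R) : 0 < e < 1 -> 0 < e' < 1 ->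
  Sigma_ e A -> Sigma_ e' B -> thompson_set A B !=set0.
Proof.
move=> /andP[e0 e1] /andP[e'0 e'1] [lA uA] [lB uB].
have ee0 : 0 < e * e' by rewrite mulr_gt0.
(* This makes [expR (- r) = e * e'], and [e e' B <= e I <= A <= e^-1 I <= (e e')^-1 B]. *)
exists (- ln (e * e')); split.
  by rewrite oppr_ge0 ln_le0// mulr_ile1// ltW.
rewrite opprK expRN lnK//; split.
  apply: lople_trans lA.
  have := lople_scale (ltW ee0) uB.
  by rewrite scalerA -real_complexM mulfK// gt_eqF.
apply: (lople_trans uA).
have := lople_scale (ltW (_ : 0 < (e * e')^-1)) lB.
rewrite scalerA -real_complexM invfM mulfVK ?gt_eqF//; apply.
by rewrite mulr_gt0 ?invr_gt0.
Qed.

Lemma thompson_set_ge A B (r s : R) : r <= s ->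
  thompson_set A B r -> thompson_set A B s.
Proof.
move=> rs [r0 [l u]]; split; first exact: le_trans rs.
split; first by apply: lople_trans l; apply: lople_scale_le; rewrite ler_expR lerN2.
by apply: (lople_trans u); apply: lople_scale_le; rewrite ler_expR.
Qed.

Lemma thompson_inf_le A B r : thompson_set A B r -> thompson A B <= r.
Proof. by apply: ge_inf; exists 0 => s []. Qed.

(** * The two inequalities *)

Lemma thompson_le_delta_T (M : Pinf H -> P) mu nu : operator_mean M ->
  ((thompson (M mu) (M nu))%:E <= delta_T mu nu)%E.
Proof.
move=> hM; apply: le_ereal_inf_tmp => _ [r [r0 [l u]] <-]; rewrite lee_fin.
apply: thompson_inf_le; split=> //; split.
  have := mean_monotone hM (l : sto_le (Pinf_scale _ nu) mu).
  by rewrite (mean_homogeneous hM).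
have := mean_monotone hM (u : sto_le mu (Pinf_scale _ nu)).
by rewrite (mean_homogeneous hM).
Qed.

Lemma delta_T_le_coupling mu nu pi (s : R) : coupling mu nu pi -> 0 <= s ->
  (forall AB, supp pi AB -> thompson_set AB.1 AB.2 s) ->
  (delta_T mu nu <= s%:E)%E.
Proof.
move=> c s0 ts; apply: ereal_inf_lbound; exists s => //; split => //.
have nS := coupling_negligible_suppC c.
have cS a U : closed U -> closed (posop_scale a @^-1` U : set P).
  by move=> cU; apply: closed_comp => // x _; exact: posop_scale_continuous.
have c1 (U : set P) : closed U -> measurable (fst @^-1` U : set (borel (P * P)%type)).
  move=> cU; apply: borel_closed; apply: closed_comp => // x _.
  exact: fst_continuous.
have c2 (U : set P) : closed U -> measurable (snd @^-1` U : set (borel (P * P)%type)).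
  move=> cU; apply: borel_closed; apply: closed_comp => // x _.
  exact: snd_continuous.
split=> U cU uU.
  (* The push-forward is unfolded and both masses become [pi]-masses of preimages under the
     projections, to be compared on [supp pi] only. *)
  rewrite -[leLHS]/(nu (posop_scale _ @^-1` U)).
  rewrite -(c _ (borel_closed cU)).1 -(c _ (borel_closed (cS _ _ cU))).2.
  apply: supp_le_measure => //; [apply: c2; exact: cS|exact: c1|].
  by move=> AB [/ts[_ [l _]] /= UB]; exact: uU UB _.
rewrite -[leRHS]/(nu (posop_scale _ @^-1` U)).
rewrite -(c _ (borel_closed cU)).1 -(c _ (borel_closed (cS _ _ cU))).2.
apply: supp_le_measure => //; [exact: c1|apply: c2; exact: cS|].
by move=> AB [/ts[_ [_ u]] /= UA]; exact: uU UA _.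
Qed.

Lemma delta_T_le_thompson_Winf mu nu : (delta_T mu nu <= thompson_Winf mu nu)%E.
Proof.
apply: le_ereal_inf_tmp => _ [pi c <-].
have ts0 AB : supp pi AB -> thompson_set AB.1 AB.2 !=set0.
  move=> /(coupling_supp c)[sA sB].
  have [_ [e e01 se]] := Pinf_condP mu; have [_ [e' e'01 se']] := Pinf_condP nu.
  exact: Sigma_thompson_set_neq0 e01 e'01 (se _ sA) (se' _ sB).
(* A point of [supp pi] is needed for [0 <= S], as the supremum of the empty set is [-oo]. *)
have [AB sAB] : supp pi !=set0.
  apply/set0P/eqP => s0; have := coupling_negligible_suppC c.
  rewrite s0 setC0 => /(negligibleP _ measurableT) /= pi0.
  by have := probability_setT pi; rewrite pi0 => /eqP; rewrite eq_sym onee_eq0.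
set S := ereal_sup _.
have ubS AB' : supp pi AB' -> ((thompson AB'.1 AB'.2)%:E <= S)%E.
  by move=> sAB'; apply: ereal_sup_ubound; exists AB'.
have S0 : (0 <= S)%E.
  apply: le_trans (ubS _ sAB); rewrite lee_fin.
  by apply: lb_le_inf; [exact: ts0|move=> r []].
case: S S0 ubS => [s| |]//; last by move=> _ _; exact: leey.
(* The slack [e] yields a member of [thompson_set] below [s + e] without the infimum having to be
   attained. *)
rewrite lee_fin => s0 ubS; apply/lee_addgt0Pr => e e0; rewrite -EFinD.
apply: (delta_T_le_coupling c); first by rewrite addr_ge0// ltW.
move=> AB' sAB'; have [r tr rs] : exists2 r, thompson_set AB'.1 AB'.2 r & r < s + e.
  apply: inf_lt; first exact: ts0.
  by rewrite (@le_lt_trans _ _ s) ?ltrDl// -lee_fin; exact: ubS.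
exact: thompson_set_ge (ltW rs) tr.
Qed.

End operators.

Theorem theorem2p8 (R : realType) (H : hilbertType R)
    (H_separable : separable_space H)
    (M : Pinf H -> posop H) (M_mean : operator_mean M) :
  Winf_contractive M /\
  forall mu nu : Pinf H,
    ((thompson (M mu) (M nu))%:E <= delta_T mu nu)%E /\
    (delta_T mu nu <= thompson_Winf mu nu)%E.
Proof.
split=> [mu nu|mu nu]; last first.
  by split; [exact: thompson_le_delta_T|exact: delta_T_le_thompson_Winf].
apply: le_trans (delta_T_le_thompson_Winf mu nu).
exact: thompson_le_delta_T.
Qed.
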